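(* Let $d\ge 2$, let $A\in\mathbb C^{d\times d}$ be a symmetric invertible matrix, and let $\Delta_A u:=\operatorname{div}(A\nabla u)=\sum_{i,j=1}^{d}A_{ij}\partial_{i}\partial_{j}u$. Put $r_A^2:=\boldsymbol r^{T}A^{-1}\boldsymbol r$ for $\boldsymbol r\in\mathbb R^d$. Let $f\in\mathcal H_n$ be non-zero, $n\in\mathbb N_0$, and let $m$ be the smallest integer such that $\Delta_A^{m+1}f\equiv 0$. Then the polynomial $$u=\sum_{\ell=0}^{m}c_\ell\, r_A^{2\ell+2}\,\Delta_A^{\ell}f,\qquad c_0=\frac{1}{2(2n+d)},\qquad c_\ell=-\frac{c_{\ell-1}}{2(\ell+1)(2n-2\ell+d)}\quad(1\le\ell\le m),$$ satisfies $\Delta_A u=f$ in $\mathbb R^d$.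
   Context: $\mathcal H_n$ denotes the $d$-variate homogeneous polynomials of total degree $n$. $\boldsymbol r$ is the position vector, $r_A^{2\ell+2}$ means $(r_A^2)^{\ell+1}$, and $A^{-1}$ is the inverse matrix, with $\boldsymbol r^T$ the transpose. *)

(* Defs.v *)
From HB Require Import structures.
From mathcomp Require Import all_boot all_order all_algebra.
From mathcomp Require Import reals complex.
From mathcomp Require Import mpoly.

Set Implicit Arguments.
Unset Strict Implicit.
Unset Printing Implicit Defensive.

Import Order.TTheory GRing.Theory Num.Theory.

Local Open Scope ring_scope.

Section AnisotropicLaplacian.

Variables (K : fieldType) (d : nat).

Definition mxC m p (A : 'M[K]_(m, p)) : 'M[{mpoly K[d]}]_(m, p) :=
  map_mx (@mpolyC d K) A.

Definition grad (u : {mpoly K[d]}) : 'cV[{mpoly K[d]}]_d :=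
  \col_i u^`M(i).

Definition div (v : 'cV[{mpoly K[d]}]_d) : {mpoly K[d]} :=
  \sum_i (v i 0)^`M(i).

Definition lap (A : 'M[K]_d) (u : {mpoly K[d]}) : {mpoly K[d]} :=
  div (mxC A *m grad u).

Lemma lapE (A : 'M[K]_d) (u : {mpoly K[d]}) :
  lap A u = \sum_i \sum_j A i j *: u^`M(j)^`M(i).
Proof.
apply: eq_bigr => i _; rewrite !mxE raddf_sum /=.
by apply: eq_bigr => j _; rewrite !mxE mul_mpolyC linearZ.
Qed.

(* The position vector: its coordinates are the indeterminates. *)
Definition posvec : 'cV[{mpoly K[d]}]_d := \col_i 'X_i.

Definition rsq (A : 'M[K]_d) : {mpoly K[d]} :=
  (posvec^T *m mxC (invmx A) *m posvec) 0 0.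

Lemma rsq_eval (A : 'M[K]_d) (x : 'cV[K]_d) :
  (rsq A).@[fun i => x i 0] = (x^T *m invmx A *m x) 0 0.
Proof.
rewrite /rsq !mxE raddf_sum /=; apply: eq_bigr => i _.
rewrite !mxE mevalM mevalXU raddf_sum /=; congr (_ * _).
by apply: eq_bigr => j _; rewrite !mxE mevalM mevalXU mevalC.
Qed.

End AnisotropicLaplacian.

Arguments div {K d} v.

(* Main.v *)
Require Import Defs.
From HB Require Import structures.
From mathcomp Require Import all_boot all_order all_algebra.
From mathcomp Require Import reals complex.
From mathcomp Require Import mpoly.
From mathcomp Require Import ring zify.

Set Implicit Arguments.
Unset Strict Implicit.
Unset Printing Implicit Defensive.

Import Order.TTheory GRing.Theory Num.Theory.

Local Open Scope ring_scope.

(** Write [rho] for [rsq A] and [r] for the position vector, and let [g] be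
homogeneous of degree [a].  Everything rests on the identity
[[
  lap A (rho^(k+1) g) = 2 (k+1) (2 k + 2 a + d) rho^k g + rho^(k+1) lap A g
]]
([lap_rsq_exp_mul]), the anisotropic form of the classical formula for the
Laplacian of a power of the radius times a homogeneous polynomial.  It comes
from two facts.  As [A] is symmetric and invertible, the inverse matrix in
[rho] cancels the matrix of the operator, so that [A grad rho = 2 r]
([mxC_mul_grad_rsq]): the flux of [rho^(k+1) g] is that of [g] scaled by
[rho^(k+1)], plus a polynomial multiple of [r].  And Euler's identity
[r . grad p = (deg p) p] for homogeneous [p] ([dot_posvec_grad]) evaluates each
inner product that appears in the divergence of this flux.

The [l]-th iterate of the operator on [f] is homogeneous of degree [n - 2 l].
With [k = l] and [a = n - 2 l], the factor in the identity is
[2 (l+1) (2 n - 2 l + d)], which is the denominator of [c l].  Hence the first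
part of the [l]-th term of [lap A u] is [f] for [l = 0], and for positive [l] it
cancels the second part of the preceding term; the sum telescopes to [f] plus a multiple of the
[(m+1)]-st iterate, which vanishes. *)

(** * Vector calculus for polynomials *)

Lemma mulmx_lincomb (S : comPzRingType) d (M : 'M[S]_d) a b (v w : 'cV[S]_d) :
  M *m (a *: v + b *: w) = a *: (M *m v) + b *: (M *m w).
Proof. by rewrite mulmxDr -!scalemxAr. Qed.

Section VectorCalculus.

Variables (K : fieldType) (d : nat).
Implicit Types (A : 'M[K]_d) (p q f g : {mpoly K[d]}).
Implicit Types (v w : 'cV[{mpoly K[d]}]_d).

Definition dot v w : {mpoly K[d]} := (v^T *m w) 0 0.

Lemma dotE v w : dot v w = \sum_i v i 0 * w i 0.
Proof. by rewrite /dot mxE; apply: eq_bigr => i _; rewrite mxE. Qed.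

Lemma dotZr v w p : dot v (p *: w) = p * dot v w.
Proof. by rewrite /dot -scalemxAr mxE. Qed.

Lemma dotC v w : dot v w = dot w v.
Proof. by rewrite !dotE; apply: eq_bigr => i _; rewrite mulrC. Qed.

Lemma grad_mul p q : grad (p * q) = p *: grad q + q *: grad p.
Proof. by apply/colP => i; rewrite !mxE mderivM addrC [q * _]mulrC. Qed.

Lemma grad_exp p k : grad (p ^+ k.+1) = (p ^+ k *+ k.+1) *: grad p.
Proof.
elim: k => [|k IHk]; first by rewrite expr1 expr0 scale1r.
rewrite exprS grad_mul IHk scalerA -scalerDl; congr (_ *: _).
by rewrite mulrnAr -exprS -mulrSr.
Qed.

Lemma divD v w : div (v + w) = div v + div w.
Proof. by rewrite -big_split; apply: eq_bigr => i _; rewrite mxE mderivD. Qed.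

Lemma div_scale p v : div (p *: v) = p * div v + dot v (grad p).
Proof.
rewrite dotE mulr_sumr -big_split; apply: eq_bigr => i _ /=.
by rewrite !mxE mderivM addrC [v i 0 * _]mulrC.
Qed.

Lemma mderiv_var (i j : 'I_d) : ('X_i : {mpoly K[d]})^`M(j) = (i == j)%:R.
Proof.
rewrite mderivX mnm1E; case: eqP => [->|_]; last by rewrite scale0r.
rewrite scale1r -mpolyX0; congr mpolyX; apply/mnmP => k.
by rewrite !mnmE subnn.
Qed.

Lemma div_posvec : div (posvec K d) = d%:R.
Proof.
rewrite /div (eq_bigr (fun=> 1)) => [|i _].
  by rewrite sumr_const card_ord.
by rewrite mxE mderiv_var eqxx.
Qed.

(** * Homogeneous polynomials *)

(** Euler's identity, checked on monomials: [X_i] times the [i]-th derivative of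
a monomial is the monomial itself, multiplied by its [i]-th exponent. *)
Lemma dot_posvec_grad n p :
  p \is n.-homog -> dot (posvec K d) (grad p) = p *+ n.
Proof.
move=> p_homog; rewrite dotE.
under eq_bigr => i _ do rewrite !mxE /mderiv mulr_sumr.
rewrite exchange_big /= [in RHS](mpolyE p) -sumrMnl.
apply: eq_big_seq => s s_p; rewrite -(dhomog_mf p_homog s_p).
rewrite -scaler_nat scalerA /= /mmeasure mdegE natr_sum mulr_suml scaler_suml; apply: eq_bigr => i _.
rewrite -scalerAr; case s_i: (s i) => [|k]; first by rewrite mul0r !scale0r.
rewrite -mpolyXD addmC submK //.
by rewrite lep1mP s_i.
Qed.

Lemma mderiv_homog n p i : p \is n.-homog -> p^`M(i) \is n.-1.-homog.
Proof.
move=> p_homog; rewrite /mderiv big_seq; apply: rpred_sum => s s_p.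
case s_i: (s i) => [|k]; first by rewrite mul0r scale0r dhomog0.
have U_s : (U_(i) <= s)%MM by rewrite lep1mP s_i.
apply: dhomogZ; rewrite dhomogX -(dhomog_mf p_homog s_p) /= -{2}(submK U_s).
by rewrite mdegD mdeg1 addn1.
Qed.

Lemma lap_homog A n p : p \is n.-homog -> lap A p \is n.-2.-homog.
Proof.
move=> p_homog; rewrite lapE; apply: rpred_sum => i _; apply: rpred_sum => j _.
by apply: dhomogZ; do 2!apply: mderiv_homog.
Qed.

(** In degree [0] the lemma [mderiv_homog] only gives degree [0] again, because the
predecessor is truncated; the vanishing is what makes high iterates zero. *)
Lemma mderiv_homog0 p i : p \is 0.-homog -> p^`M(i) = 0.
Proof.
move=> p_homog; rewrite /mderiv big_seq big1 // => s s_p.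
have /eqP := dhomog_mf p_homog s_p; rewrite /= mdeg_eq0 => /eqP ->.
by rewrite mnm0E mul0r scale0r.
Qed.

Lemma lap_homog_lt2 A n p : (n < 2)%N -> p \is n.-homog -> lap A p = 0.
Proof.
move=> n_lt2 p_homog; rewrite lapE big1 // => i _; rewrite big1 // => j _.
rewrite [_^`M(i)]mderiv_homog0 ?scaler0 //.
by have := mderiv_homog j p_homog; case: n n_lt2 {p_homog} => [|[]].
Qed.

Lemma iter_lap_homog A n f l :
  f \is n.-homog -> iter l (lap A) f \is (n - l.*2).-homog.
Proof.
move=> f_homog; elim: l => [|l IHl]; first by rewrite subn0.
by rewrite iterS doubleS -addn2 subnDA subn2; apply: lap_homog.
Qed.

(** Together with [iter_lap_homog] this says that the truncated subtraction
[n - l.*2] is the true degree whenever the iterate is not zero. *)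
Lemma iter_lap_eq0 A n f l :
  f \is n.-homog -> (n < l.*2)%N -> iter l (lap A) f = 0.
Proof.
case: l => // l f_homog n_lt; rewrite iterS.
apply: lap_homog_lt2 (iter_lap_homog A l f_homog).
by rewrite ltn_psubLR // addn2.
Qed.

(** * The quadratic form and the operator *)

Lemma rsqE A :
  rsq A = \sum_j (\sum_i 'X_i * (invmx A i j)%:MP) * 'X_j.
Proof.
rewrite /rsq mxE; apply: eq_bigr => j _; rewrite !mxE; congr (_ * _).
by apply: eq_bigr => i _; rewrite !mxE.
Qed.

Lemma rsq_homog A : rsq A \is 2.-homog.
Proof.
rewrite rsqE; apply: rpred_sum => j _; rewrite mulr_suml.
apply: rpred_sum => i _; rewrite mulrAC mulrC mul_mpolyC.
by apply: dhomogZ; apply: (@dhomogM _ _ _ 1 _ 1); rewrite dhomogX /= mdeg1.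
Qed.

Lemma grad_rsq A :
  A^T = A -> grad (rsq A) = 2 *: (mxC d (invmx A) *m posvec K d).
Proof.
move=> A_sym; apply/colP => k; rewrite !mxE rsqE raddf_sum /=.
have invC i j : invmx A i j = invmx A j i.
  by rewrite -[in LHS]A_sym -trmx_inv mxE.
under eq_bigr => j _.
  rewrite mderivM mderiv_var raddf_sum /=.
  under eq_bigr => i _ do rewrite mderivM mderiv_var mderivC mulr0 addr0.
  rewrite (bigD1 k) //= big1 ?eqxx ?mul1r ?addr0 => [|i /negPf->]; last first.
    by rewrite mul0r.
  over.
rewrite big_split /= [X in _ + X](bigD1 k) //= eqxx mulr1.
rewrite [X in _ + (_ + X)]big1 ?addr0 => [|j /negPf->]; last by rewrite mulr0.
rewrite mulr_natl mulr2n; congr (_ + _); apply: eq_bigr => j _; rewrite !mxE //.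
by rewrite mulrC invC.
Qed.

(** The reason for the inverse matrix in the quadratic form: with respect to
[A], its gradient is radial. *)
Lemma mxC_mul_grad_rsq A :
  A^T = A -> A \in unitmx -> mxC d A *m grad (rsq A) = 2 *: posvec K d.
Proof.
move=> A_sym A_inv; rewrite (grad_rsq A_sym) -scalemxAr mulmxA /mxC -map_mxM.
by rewrite (mulmxV A_inv) map_mx1 mul1mx.
Qed.

(** The flux of [rho^(k+1) g] is [rho^(k+1) (A grad g) + q r], where
[q = 2 (k+1) rho^k g].  The divergence of the first summand is [rho^(k+1) lap A g]
plus [(k+1) rho^k] times [(A grad g) . grad rho = 2 r . grad g], where the
symmetry of [A] is used once more; that of the second is [d q + r . grad q].
Both inner products with [r] are given by Euler's identity. *)
Lemma lap_rsq_exp_mul A n k g :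
    A^T = A -> A \in unitmx -> g \is n.-homog ->
  lap A (rsq A ^+ k.+1 * g) =
    (rsq A ^+ k * g) *+ (2 * k.+1 * (2 * k + 2 * n + d))
    + rsq A ^+ k.+1 * lap A g.
Proof.
move=> A_sym A_inv g_homog; set rho := rsq A.
pose q : {mpoly K[d]} := (rho ^+ k * g) *+ (2 * k.+1).
have q_homog : q \is (2 * k + n).-homog.
  by apply/rpredMn/dhomogM => //; apply/dhomogMn/rsq_homog.
have A_grad : mxC d A *m grad (rho ^+ k.+1 * g) =
    rho ^+ k.+1 *: (mxC d A *m grad g) + q *: posvec K d.
  rewrite grad_mul grad_exp scalerA mulmx_lincomb.
  rewrite (mxC_mul_grad_rsq A_sym A_inv) [X in _ + X]scalerA.
  by congr (_ + _ *: _); rewrite /q; ring.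
have A_grad_rho : dot (mxC d A *m grad g) (grad rho) = 2 * (g *+ n).
  rewrite /dot trmx_mul -mulmxA /mxC map_trmx A_sym -/(mxC d A).
  rewrite (mxC_mul_grad_rsq A_sym A_inv) -/(dot _ _) dotZr dotC.
  by rewrite (dot_posvec_grad g_homog).
rewrite /lap A_grad divD !div_scale grad_exp dotZr A_grad_rho div_posvec.
rewrite (dot_posvec_grad q_homog) /q; ring.
Qed.

Lemma lapD A f g : lap A (f + g) = lap A f + lap A g.
Proof.
rewrite /lap -divD -mulmxDr; congr (div (_ *m _)).
by apply/colP => i; rewrite !mxE mderivD.
Qed.

Lemma lapZ A c f : lap A (c *: f) = c *: lap A f.
Proof.
rewrite !lapE scaler_sumr; apply: eq_bigr => i _; rewrite scaler_sumr.
by apply: eq_bigr => j _; rewrite !mderivZ !scalerA mulrC.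
Qed.

End VectorCalculus.

(** * The particular solution *)

Theorem mainTheorem3 (R : realType) (d : nat) (hd : (2 <= d)%N)
    (A : 'M[R[i]]_d) (hAsym : A^T = A) (hAinv : A \in unitmx)
    (n : nat) (f : {mpoly R[i][d]}) (hf : f \is n.-homog) (hf0 : f != 0)
    (m : nat) (hm : iter m.+1 (lap A) f = 0)
    (hmin : forall k : nat, iter k.+1 (lap A) f = 0 -> (m <= k)%N)
    (c : nat -> R[i])
    (hc0 : c 0%N = 1 / (2 * (2 * n%:R + d%:R)))
    (hc : forall l : nat, (1 <= l <= m)%N ->
       c l = - (c l.-1 / (2 * (l%:R + 1) * (2 * n%:R - 2 * l%:R + d%:R)))) :
  let u := \sum_(0 <= l < m.+1) c l *: (rsq A ^+ l.+1 * iter l (lap A) f) in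
  lap A u = f.
Proof.
move=> u; rewrite {}/u; set rho := rsq A.
(* Of the terms up to index [j], only [f] and the second part of the last one
   survive. *)
suff telescope j : (j <= m)%N ->
    lap A (\sum_(0 <= l < j.+1) c l *: (rho ^+ l.+1 * iter l (lap A) f)) =
      f + c j *: (rho ^+ j.+1 * iter j.+1 (lap A) f).
  by rewrite telescope // hm mulr0 scaler0 addr0.
elim: j => [|j IHj] j_le.
  rewrite big_nat1 lapZ (lap_rsq_exp_mul 0 hAsym hAinv hf) scalerDr.
  rewrite expr0 mul1r -scaler_nat scalerA hc0 [_ * _%:R](_ : _ = 1) ?scale1r //.
  have dn_neq0 : (2 * n%:R + d%:R : R[i]) != 0.
    by rewrite -natrM -natrD pnatr_eq0 -lt0n addn_gt0 (ltnW hd) orbT.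
  by field; rewrite dn_neq0.
rewrite big_nat_recr // lapD IHj ?(ltnW j_le) // lapZ.
have g_homog := iter_lap_homog A j.+1 hf.
rewrite (lap_rsq_exp_mul j.+1 hAsym hAinv g_homog) -(iterS j.+1) scalerDr.
suff cancel : c j.+1 *: ((rho ^+ j.+1 * iter j.+1 (lap A) f)
      *+ (2 * j.+2 * (2 * j.+1 + 2 * (n - j.+1.*2) + d)))
    = - (c j *: (rho ^+ j.+1 * iter j.+1 (lap A) f)).
  by rewrite cancel addrA addrK.
(* If the degree is exhausted, the iterate is zero.  Otherwise the subtraction
   [n - j.+1.*2] is exact, and the factor is the denominator of [c j.+1]. *)
have [n_lt | n_ge] := ltnP n j.+1.*2.
  by rewrite (iter_lap_eq0 A hf n_lt) mulr0 mul0rn !scaler0 oppr0.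
rewrite -scaler_nat scalerA -scaleNr hc //=; congr (_ *: _).
have N_neq0 : (2 * n%:R - 2 * j.+1%:R + d%:R : R[i]) != 0.
  rewrite -!natrM -natrB; last by lia.
  by rewrite -natrD pnatr_eq0; lia.
rewrite !natrM !natrD !natrM natrB // -mul2n natrM.
by field; rewrite nat1r N_neq0 natr1 pnatr_eq0.
Qed.
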